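(* Let $G$ be a connected graph of order $n$. Then $\sigma_1(G)\ge n-1$, with equality if and only if $G\cong K_{1,n-1}$.
   Context: Graphs are finite, simple and undirected, with at least one vertex; the order of a graph is its number of vertices. For a graph $G$, $\sigma_1(G)$ denotes the number of $1$-nearly independent vertex subsets of $G$, i.e. the number of subsets $I$ of the vertex set $V(G)$ such that the subgraph of $G$ induced by $I$ has exactly one edge. $K_{1,n-1}$ is the star on $n$ vertices: one central vertex adjacent to each of $n-1$ pairwise nonadjacent other vertices (for $n=1$ this is read as the one-vertex graph $K_1$). *)

(* Defs.v *)
From mathcomp Require Import all_boot.
Set Implicit Arguments.
Unset Strict Implicit.
Unset Printing Implicit Defensive.

(* Finite simple undirected graphs.  The empty graph is included, so that
   every vertex subset, including the empty one, induces a graph. *)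
Record sgraph := SGraph {
  vertex :> finType;
  adj : rel vertex;
  adj_sym : symmetric adj;
  adj_irr : irreflexive adj
}.

(* Each edge is the 2-element set of its ends, hence is counted once. *)
Definition edges (G : sgraph) : {set {set G}} :=
  [set [set p.1; p.2] | p : G * G & adj p.1 p.2].

Definition induced_adj (G : sgraph) (I : {set G}) : rel {x : G | x \in I} :=
  fun x y => adj (val x) (val y).

Lemma induced_sym (G : sgraph) (I : {set G}) : symmetric (@induced_adj G I).
Proof. by move=> x y; apply: adj_sym. Qed.

Lemma induced_irr (G : sgraph) (I : {set G}) : irreflexive (@induced_adj G I).
Proof. by move=> x; apply: adj_irr. Qed.

Definition induced (G : sgraph) (I : {set G}) : sgraph :=
  SGraph (@induced_sym G I) (@induced_irr G I).

Definition sigma1 (G : sgraph) : nat :=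
  #|[set I : {set G} | #|edges (induced I)| == 1]|.

Definition connected (G : sgraph) : Prop :=
  forall x y : G, connect (@adj G) x y.

Definition isomorphic (G H : sgraph) : Prop :=
  exists2 f : G -> H, bijective f & forall x y, adj (f x) (f y) = adj x y.

(* The star K_{1,m}: [None] is the centre, the [Some i] are the m leaves;
   in particular K_{1,0} is the one-vertex graph. *)
Definition star_adj (m : nat) : rel (option 'I_m) :=
  fun x y => (x == None) != (y == None).

Lemma star_sym (m : nat) : symmetric (@star_adj m).
Proof. by move=> x y; rewrite /star_adj eq_sym. Qed.

Lemma star_irr (m : nat) : irreflexive (@star_adj m).
Proof. by move=> x; rewrite /star_adj eqxx. Qed.

Definition star (m : nat) : sgraph := SGraph (@star_sym m) (@star_irr m).

(* Main.v *)
(* Fix an edge uv. Every vertex w other than u yields a vertex subset inducing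
   exactly one edge, and w can be recovered from it: an edge joining w to u or
   v if there is one, and {u, v, w} otherwise. This gives sigma1 G >= n - 1.
   If equality holds there are no other such subsets. In particular every edge
   meets {u, v}; as no vertex is isolated, every vertex is adjacent to u or v,
   and to only one of them. If w <> v were a neighbour of u and x <> u one of
   v, then {u, w, x} would be a further subset; so G is a star centred at u or
   at v. *)
Require Import Defs.
From mathcomp Require Import all_boot.

Set Implicit Arguments.
Unset Strict Implicit.
Unset Printing Implicit Defensive.

Definition one_edge_sets (G : sgraph) : {set {set G}} :=
  [set I : {set G} | #|edges (induced I)| == 1].

(** Edges of [induced I] are sets over a subtype; taking images under [val], injective on sets,
    moves the condition into [G]. *)
Lemma one_edge_setsP (G : sgraph) (I : {set G}) :
  reflect (exists x y, [/\ x \in I, y \in I, adj x y &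
             forall a b, a \in I -> b \in I -> adj a b ->
               [set a; b] = [set x; y]])
          (I \in one_edge_sets G).
Proof.
rewrite inE; apply: (iffP cards1P) => [[A eA]|[x [y [xI yI xy uniq_xy]]]].
  have: A \in edges (induced I) by rewrite eA set11.
  case/imsetP=> -[x y]; rewrite inE /= => xy defA.
  exists (val x), (val y); split=> [||//|a b aI bI ab]; [exact: valP..|].
  have: [set exist _ a aI; exist _ b bI] \in edges (induced I).
    by apply/imsetP; exists (exist _ a aI, exist _ b bI); rewrite ?inE.
  rewrite eA defA inE => /eqP/(congr1 (fun B : {set induced I} => val @: B)).
  by rewrite !imsetU1 !imset_set1.
exists [set exist _ x xI; exist _ y yI]; apply/setP=> B; rewrite inE.
apply/imsetP/eqP=> [[[a b]]|->]; last first.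
  by exists (exist _ x xI, exist _ y yI); rewrite ?inE.
rewrite inE /= => ab ->; apply: (imset_inj val_inj).
rewrite !imsetU1 !imset_set1 /=; apply: uniq_xy => //; exact: valP.
Qed.

Lemma edge_one_edge (G : sgraph) (x y : G) :
  adj x y -> [set x; y] \in one_edge_sets G.
Proof.
move=> xy; apply/one_edge_setsP; exists x, y; split=> //; rewrite ?set21 ?set22//.
move=> a b /set2P[]-> /set2P[]->; rewrite ?adj_irr // => _.
exact: setUC.
Qed.

Lemma edge_far_one_edge (G : sgraph) (x y w : G) :
  adj x y -> ~~ adj x w -> ~~ adj y w -> [set x; y; w] \in one_edge_sets G.
Proof.
move=> xy /negPf xw /negPf yw; apply/one_edge_setsP.
exists x, y; split=> //; rewrite ?inE ?eqxx ?orbT //.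
move=> a b; rewrite !inE -!orbA.
by move=> /or3P[]/eqP-> /or3P[]/eqP->; rewrite ?adj_irr ?xw ?yw // => /[1!adj_sym];
  rewrite ?xw ?yw // setUC.
Qed.

Definition star_center (G : sgraph) (c : G) : Prop :=
  forall x y : G, adj x y = ((x == c) != (y == c)).

Lemma isomorphic_star (G : sgraph) :
  0 < #|G| -> isomorphic G (star (#|G| - 1)) <-> exists c : G, star_center c.
Proof.
move=> G_gt0; split=> [[f [g fK gK] fadj]|[c cP]].
  exists (g None) => x y.
  by rewrite -fadj /= /star_adj -!(can2_eq fK gK).
pose T := {x : G | x != c}.
have cardT : #|{: T}| = #|G| - 1 by rewrite card_sig cardC1 subn1.
(* [insub] fails exactly at [c], which goes to the centre [None]; any other vertex goes to its rank
   in [T]. *)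
pose f (x : G) : star (#|G| - 1) :=
  omap (fun t : T => cast_ord cardT (enum_rank t)) (insub x).
have f_None x : (f x == None) = (x == c).
  by rewrite /f; case: insubP => [t /negPf-> //|/negPn->].
have f_inj : injective f.
  move=> x y /[dup] + /eqP.
  rewrite /f; case: insubP => [s _ <-|/negPn/eqP->];
    case: insubP => [t _ <-|/negPn/eqP->] //=.
  by move=> [] /ord_inj/enum_rank_inj->.
exists f => [|x y]; last by rewrite /= /star_adj !f_None cP.
by apply: inj_card_bij f_inj _; rewrite card_option card_ord subn1 prednK.
Qed.

(** The sets inducing exactly one edge are the pairs [[set c; w]] with [w != c]: every edge contains
    [c], and each further vertex beside [c] would add an edge. *)
Lemma sigma1_star_center (G : sgraph) (c : G) :
  star_center c -> sigma1 G = #|G| - 1.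
Proof.
move=> cP.
have pair_inj : {in [set~ c] &, injective (fun w => [set c; w])}.
  move=> w x; rewrite !inE => /negPf wc _ eq_cw.
  by have := set22 c w; rewrite eq_cw !inE wc => /eqP.
have -> : sigma1 G = #|[set [set c; w] | w in [set~ c]]|.
  apply: eq_card => I; apply/one_edge_setsP/imsetP=> [|[w]]; last first.
    rewrite !inE => wc ->; apply/one_edge_setsP/edge_one_edge.
    by rewrite cP eqxx (negPf wc).
  have center x y : x \in I -> y \in I -> adj x y ->
      (forall a b, a \in I -> b \in I -> adj a b -> [set a; b] = [set x; y]) ->
      x = c -> exists2 w, w \in [set~ c] & I = [set c; w].
    move=> + yI + + xc; rewrite {}xc cP eqxx => cI yc uniq_cy.
    exists y; first by move: yc; rewrite !inE; case: (y == c).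
    apply/setP=> z; apply/idP/set2P=> [zI|[]-> //].
    have [->|zc] := eqVneq z c; first by left.
    apply/set2P; rewrite -(uniq_cy c z) ?set22 //.
    by rewrite cP eqxx (negPf zc).
  move=> [x [y [xI yI xy uniq_xy]]].
  have := xy; rewrite cP; have [xc _|_] := eqVneq x c; first exact: (center x y).
  have [yc _|//] := eqVneq y c.
  apply: (center y x) => //; first by rewrite adj_sym.
  by move=> a b aI bI /uniq_xy-> //; rewrite setUC.
by rewrite card_in_imset // cardsC1 subn1.
Qed.

(** With [u] and [v] adjacent, [w = v] yields the edge uv itself; so would [w = u], hence only
    vertices other than [u] are used. *)
Definition edge_witness (G : sgraph) (u v w : G) : {set G} :=
  if adj u w then [set u; w] else if adj v w then [set v; w] else [set u; v; w].

Section EdgeWitness.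
Variables (G : sgraph) (u v : G).
Hypothesis uv : adj u v.

Let witnesses : {set {set G}} := edge_witness u v @: [set~ u].

Lemma edge_witness_one_edge w : edge_witness u v w \in one_edge_sets G.
Proof.
rewrite /edge_witness; case: ifPn => [|uw]; first exact: edge_one_edge.
case: ifPn => [|vw]; first exact: edge_one_edge.
exact: edge_far_one_edge.
Qed.

(** The set built from [x] contains [x] and, apart from [u] and [v], nothing else. If [w] and [x]
    give the same set, then they are equal or both are [v]. *)
Lemma edge_witness_inj : {in [set~ u] &, injective (edge_witness u v)}.
Proof.
have sub w x : w != u -> w \in edge_witness u v x -> w = x \/ w = v.
  rewrite /edge_witness => /negPf wu.
  by do 2?case: ifP => _; rewrite !inE ?wu /=;
    try (by move/eqP; left); case/orP=> /eqP; auto.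
have mem w : w \in edge_witness u v w.
  by rewrite /edge_witness; do 2?case: ifP => _; rewrite !inE eqxx ?orbT.
move=> w x; rewrite !inE => wu xu eq_wx.
have := sub w x wu; rewrite -eq_wx => /(_ (mem w)) [//|wv].
have := sub x w xu; rewrite eq_wx => /(_ (mem x)) [//|xv].
by rewrite wv xv.
Qed.

Lemma card_edge_witness : #|witnesses| = #|G| - 1.
Proof. by rewrite card_in_imset ?cardsC1 ?subn1 //; apply: edge_witness_inj. Qed.

Lemma edge_witness_sub : witnesses \subset one_edge_sets G.
Proof. by apply/subsetP=> _ /imsetP[w _ ->]; apply: edge_witness_one_edge. Qed.

Lemma sigma1_ge : #|G| - 1 <= sigma1 G.
Proof. by rewrite -card_edge_witness subset_leq_card // edge_witness_sub. Qed.

Lemma sigma1_eq_star_center :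
  (forall x : G, exists y, adj x y) -> sigma1 G = #|G| - 1 ->
  exists c : G, star_center c.
Proof.
move=> neighbour sigma1_eq.
have witnessed I : I \in one_edge_sets G ->
    exists2 w, w != u & I = edge_witness u v w.
  have /eqP <- : witnesses == one_edge_sets G.
    by rewrite eqEcard edge_witness_sub card_edge_witness -sigma1_eq leqnn.
  by case/imsetP=> w; rewrite !inE; exists w.
(* The edge is itself a witness, and every witness contains [u] or [v]. *)
have meets x y : adj x y -> (x \in [set u; v]) || (y \in [set u; v]).
  move=> /edge_one_edge/witnessed[w _ eq_xy].
  have : (u \in [set x; y]) || (v \in [set x; y]).
    by rewrite eq_xy /edge_witness; do 2?case: ifP => _; rewrite !inE eqxx ?orbT.
  by rewrite !inE -!(eq_sym u) -!(eq_sym v); do 4?case: (_ == _).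
have dominated w : adj u w || adj v w.
  have [y wy] := neighbour w; move: (meets w y wy); rewrite !inE -!orbA.
  by case/or4P=> /eqP eq_; move: wy; rewrite ?eq_ ?uv ?[adj w _]adj_sym ?[adj v u]adj_sym
    ?uv ?orbT // => ->; rewrite ?orbT.
(* In a triangle uvw, the edge vw would be the witness of some [x]. It avoids [u], so it is
   [[set v; x]] with [x] not adjacent to [u]; but then [x = w]. *)
have not_both w : adj u w -> adj v w -> False.
  move=> uw vw; have /witnessed[x _] := edge_one_edge vw.
  have neq_uv : u != v by apply: contraTneq uv => ->; rewrite adj_irr.
  have neq_uw : u != w by apply: contraTneq uw => ->; rewrite adj_irr.
  have neq_vw : v != w by apply: contraTneq vw => ->; rewrite adj_irr.
  rewrite /edge_witness; case: ifPn => [_|ux] eq_vw.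
    by have := set21 u x; rewrite -eq_vw !inE (negPf neq_uv) (negPf neq_uw).
  have vx : adj v x by have := dominated x; rewrite (negPf ux).
  have := set22 v w; rewrite eq_vw vx !inE eq_sym (negPf neq_vw) /= => /eqP wx.
  by rewrite -wx uw in ux.
have one_sided w x : adj u w -> w != v -> adj v x -> x != u -> False.
  move=> uw wv vx xu.
  have ux : ~~ adj u x by apply/negP=> /not_both/(_ vx).
  have wu : w != u by apply: contraTneq uw => ->; rewrite adj_irr.
  have xv : x != v by apply: contraTneq vx => ->; rewrite adj_irr.
  have wx : ~~ adj w x.
    by apply/negP=> /meets; rewrite !inE (negPf wu) (negPf wv) (negPf xu) (negPf xv).
  have neq_wx : w != x by apply: contraNneq ux => <-.
  have /witnessed[y _ eq_uwx] := edge_far_one_edge uw ux wx.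
  (* By [dominated] the three-vertex branch never occurs, whereas [[set u; w; x]] has three
     elements. *)
  have : #|edge_witness u v y| <= 2.
    rewrite /edge_witness; case: ifPn => [_|uy]; first by rewrite cards2; case: (_ != _).
    have := dominated y; rewrite (negPf uy) /= => ->.
    by rewrite cards2; case: (_ != _).
  rewrite -eq_uwx -setUA cardsU1 cards2 neq_wx !inE eq_sym (negPf wu).
  by rewrite eq_sym (negPf xu).
(* The ends are renamed so that either can serve as centre. An edge avoiding [c] must contain [d],
   and its other end would be adjacent to both. *)
have centered c d : adj c d -> [set u; v] = [set c; d] ->
    (forall w, adj c w -> adj d w -> False) ->
    (forall w, w != c -> adj c w) -> star_center c.
  move=> cd eq_cd not_cd c_adj x y.
  have [->|xc] := eqVneq x c.
    have [->|/c_adj-> //] := eqVneq y c; exact: adj_irr.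
  have [->|yc] := eqVneq y c; first by rewrite adj_sym c_adj.
  apply/negP=> xy; move: (meets x y xy).
  rewrite eq_cd !inE (negPf xc) (negPf yc) /= => /orP[]/eqP eq_d.
    by apply: not_cd (c_adj _ yc) _; rewrite -eq_d.
  by apply: not_cd (c_adj _ xc) _; rewrite -eq_d adj_sym.
have [/forallP u_adj|] := boolP [forall w, (w != u) ==> adj u w].
  exists u; apply: (@centered u v) => // w; exact/implyP/u_adj.
(* A vertex [x] missed by [u] is adjacent to [v]; by [one_sided], [u] then has no neighbour but [v],
   so [v] is the centre. *)
case/forallPn=> x; rewrite negb_imply => /andP[xu ux].
have vx : adj v x by have := dominated x; rewrite (negPf ux).
exists v; apply: (@centered v u) => [||w vw uw|w wv].
- by rewrite adj_sym.
- exact: setUC.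
- exact: not_both vw.
by have /orP[uw|//] := dominated w; case: (one_sided w x).
Qed.

End EdgeWitness.

Lemma connected_neighbour (G : sgraph) (x : G) :
  connected G -> 1 < #|G| -> exists y, adj x y.
Proof.
move=> conG; rewrite (cardD1 x) => /card_gt0P[z]; rewrite !inE andbT => zx.
have /connectP[[|y p] /=] := conG x z; first by move=> _ eq_zx; rewrite eq_zx eqxx in zx.
by case/andP=> xy _ _; exists y.
Qed.

Theorem corollary1 (G : sgraph) (n : nat) (hn : #|G| = n) (hpos : 0 < n)
    (hG : connected G) :
  n - 1 <= sigma1 G /\ (sigma1 G = n - 1 <-> isomorphic G (star (n - 1))).
Proof.
subst n; have [iso_center center_iso] := isomorphic_star hpos.
have iso_sigma1 : isomorphic G (star (#|G| - 1)) -> sigma1 G = #|G| - 1.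
  by case/iso_center=> c; apply: sigma1_star_center.
(* With a single vertex there is no edge to fix: the bound is 0 and that vertex is a centre. *)
have [G_le1|G_gt1] := leqP #|G| 1.
  have [c _] := card_gt0P hpos; split.
    by move: G_le1; rewrite -subn_eq0 => /eqP->.
  split=> // _; apply: center_iso; exists c => x y.
  have G_c := fintype_le1P G_le1 c.
  by rewrite (G_c x) (G_c y) adj_irr eqxx.
have [u _] := card_gt0P hpos.
have neighbour x := connected_neighbour x hG G_gt1.
have [v uv] := neighbour u.
split; first exact: sigma1_ge uv.
by split=> // /(sigma1_eq_star_center uv neighbour).
Qed.
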